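(* Let $0<\varepsilon<\frac12$, $0<\delta<1$, $\zeta>0$ with $\zeta\delta<1$, and $\rho>0$. Let $n_1<n_2<\cdots<n_s$ be the ascending arrangement of all distinct elements of $$\left\{\left\lceil\left(\frac{24\varepsilon-16\varepsilon^2}{9}\right)^{1-\frac{i}{\tau}}\frac{\ln\frac{1}{\zeta\delta}}{2\varepsilon^2}\right\rceil : i=0,1,\ldots,\tau\right\},\qquad \tau=\left\lceil\frac{\ln\frac{9}{24\varepsilon-16\varepsilon^2}}{\ln(1+\rho)}\right\rceil .$$ For $\ell=1,\ldots,s$, define $K_\ell=\sum_{i=1}^{n_\ell}X_i$, $\widehat{p}_\ell=K_\ell/n_\ell$, and let $D_\ell=1$ if $$\left(\left|\widehat{p}_\ell-\tfrac12\right|-\tfrac{2\varepsilon}{3}\right)^2\ge\frac14+\frac{\varepsilon^2n_\ell}{2\ln(\zeta\delta)}$$ and $D_\ell=0$ otherwise. Sampling is continued until $D_\ell=1$ for some $\ell\in\{1,\ldots,s\}$. Let $\mathbf{n}$ be the sample size when sampling is terminated and let $\widehat{p}=\frac{1}{\mathbf n}\sum_{i=1}^{\mathbf n}X_i$. Define $$\mathscr{Q}^+=\bigcup_{\ell=1}^s\left\{\frac{k}{n_\ell}+\varepsilon\in\left(0,\tfrac12\right):k\in\mathbb{Z}\right\}\cup\left\{\tfrac12\right\},\qquad \mathscr{Q}^-=\bigcup_{\ell=1}^s\left\{\frac{k}{n_\ell}-\varepsilon\in\left(0,\tfrac12\right):k\in\mathbb{Z}\right\}\cup\left\{\tfrac12\right\}.$$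 Then a sufficient condition to guarantee $\Pr\{|\widehat{p}-p|<\varepsilon\mid p\}>1-\delta$ for every $p\in(0,1)$ is that $$\sum_{\ell=1}^s\Pr\{\widehat{p}_\ell\ge p+\varepsilon,\ D_{\ell-1}=0,\ D_\ell=1\mid p\}<\frac{\delta}{2}\quad\text{for all }p\in\mathscr{Q}^-,$$ $$\sum_{\ell=1}^s\Pr\{\widehat{p}_\ell\le p-\varepsilon,\ D_{\ell-1}=0,\ D_\ell=1\mid p\}<\frac{\delta}{2}\quad\text{for all }p\in\mathscr{Q}^+.$$ Moreover, both of these conditions are satisfied if $0<\zeta<\frac{1}{2(\tau+1)}$.
   Context: $X_1,X_2,\ldots$ are i.i.d. Bernoulli random variables with $\Pr\{X_i=1\}=1-\Pr\{X_i=0\}=p\in(0,1)$; $\Pr\{\cdot\mid p\}$ denotes probability when the Bernoulli parameter is $p$. $\lceil x\rceil$ is the smallest integer not less than $x$. By convention $D_0=0$. Sampling stops at the smallest index $\ell\ge1$ with $D_\ell=1$, and then $\mathbf n=n_\ell$ and $\widehat p=\widehat p_\ell$. *)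

(* Defs.v *)
From HB Require Import structures.
From mathcomp Require Export all_boot all_order all_algebra.
From mathcomp Require Export all_classical all_reals all_analysis.

Set Implicit Arguments.
Unset Strict Implicit.
Unset Printing Implicit Defensive.

Import Order.TTheory GRing.Theory Num.Theory.
Import numFieldNormedType.Exports.

Local Open Scope classical_set_scope.
Local Open Scope ring_scope.

Section iid_bernoulli.
Context {d : measure_display} {T : measurableType d} {R : realType}.
Implicit Types (Pr : probability T R) (X : nat -> T -> R).

Definition mutually_independent Pr X : Prop :=
  forall (J : seq nat) (B : nat -> set R),
    uniq J -> (forall i, measurable (B i)) ->
    Pr (\bigcap_(i in [set` J]) (X i @^-1` B i)) =
    (\prod_(i <- J) Pr (X i @^-1` B i))%E.

(* Being identically distributed is part of the second and third clauses. *)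
Definition iid_bernoulli Pr X (p : R) : Prop :=
  [/\ mutually_independent Pr X,
      forall i, Pr (X i @^-1` [set 1]) = p%:E &
      forall i, Pr (X i @^-1` [set 0]) = (1 - p)%:E].

End iid_bernoulli.

Section sampling_scheme.
Context {R : realType}.
Variables (eps delta zeta rho : R).

(* Both ceilings are applied to nonnegative reals when 0 < eps < 1/2, 0 < rho and
   0 < zeta * delta < 1, so the absolute value is only the cast to nat. *)
Definition tau : nat :=
  `|Num.ceil (ln (9 / (24 * eps - 16 * eps ^+ 2)) / ln (1 + rho))|%N.

Definition raw_size (i : nat) : nat :=
  `|Num.ceil (((24 * eps - 16 * eps ^+ 2) / 9) `^ (1 - i%:R / tau%:R)
              * (ln (1 / (zeta * delta)) / (2 * eps ^+ 2)))|%N.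

Definition sizes : seq nat :=
  sort leq (undup [seq raw_size i | i <- iota 0 tau.+1]).

Definition nstages : nat := size sizes.

(* The stages are numbered 1, ..., nstages. *)
Definition nsize (l : nat) : nat := nth 0%N sizes l.-1.

Section statistics.
Context {T : Type}.
(* [X i] is the (i+1)-st observation. *)
Variable X : nat -> T -> R.

Definition sample_mean (n : nat) (w : T) : R := (\sum_(i < n) X i w) / n%:R.

Definition phat (l : nat) (w : T) : R := sample_mean (nsize l) w.

(* [decision l w] stands for D_l = 1; the conjunct [0 < l] is D_0 = 0. *)
Definition decision (l : nat) (w : T) : bool :=
  (0 < l)%N &&
  ((`|phat l w - 1 / 2| - 2 * eps / 3) ^+ 2
     >= 1 / 4 + eps ^+ 2 * (nsize l)%:R / (2 * ln (zeta * delta))).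

(* The least l in {1, ..., nstages} with D_l = 1.  For admissible parameters
   one exists at every w: the largest sample size is that of i = tau, for which
   the threshold is <= 0.  Otherwise [find] would return nstages.+1. *)
Definition stopping_stage (w : T) : nat :=
  (find (fun l => decision l w) (iota 1 nstages)).+1.

Definition final_size (w : T) : nat := nsize (stopping_stage w).

Definition final_phat (w : T) : R := sample_mean (final_size w) w.

End statistics.

Definition Qplus : set R :=
  \bigcup_(l in [set l | (1 <= l <= nstages)%N])
    [set q | 0 < q < 1 / 2 /\
             exists k : int, q = k%:~R / (nsize l)%:R + eps]
  `|` [set 1 / 2].

Definition Qminus : set R :=
  \bigcup_(l in [set l | (1 <= l <= nstages)%N])
    [set q | 0 < q < 1 / 2 /\
             exists k : int, q = k%:~R / (nsize l)%:R - eps]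
  `|` [set 1 / 2].

Section conditions.
Context {d : measure_display} {T : measurableType d}.
(* [Pr p] is the law under which the Bernoulli parameter is p. *)
Variables (Pr : R -> probability T R) (X : nat -> T -> R).

Definition upper_condition : Prop :=
  forall p, Qminus p ->
    (\sum_(1 <= l < nstages.+1)
       Pr p [set w | [/\ (phat X l w >= p + eps)%R,
                         decision X l.-1 w = false &
                         decision X l w = true]] < (delta / 2)%:E)%E.

Definition lower_condition : Prop :=
  forall p, Qplus p ->
    (\sum_(1 <= l < nstages.+1)
       Pr p [set w | [/\ (phat X l w <= p - eps)%R,
                         decision X l.-1 w = false &
                         decision X l w = true]] < (delta / 2)%:E)%E.

End conditions.
End sampling_scheme.

(* Main.v *)
(* The likelihood [p^K (1 - p)^(n - K)] is nondecreasing in [p] up to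
   [K / n].  Hence, between two consecutive points of [Qminus], where the event
   [phat >= p + eps] at a given stage does not change, its probability is
   nondecreasing in [p], and it is enough to control it on [Qminus]; likewise for
   [phat <= p - eps] and [Qplus].  The symmetry [p |-> 1 - p] reduces the problem to
   [p <= 1/2], and a union bound over the stages concludes.

   When [zeta] is small: the stopping rule is Massart's inequality in
   disguise: [decision] at stage [l] means that Massart's bound on
   [Pr(phat_l <= z)], taken at [z = phat_l] and true parameter [z + eps], is at most
   [zeta * delta].  Each of the at most [tau + 1] stages thus contributes at most
   [zeta * delta].  Massart's inequality follows from Chernoff's, because the relative
   entropy of [z] and [p] is [p h(z / p) + (1 - p) h((1 - z) / (1 - p))] with
   [h y = y ln y - y + 1 >= 3 (y - 1)^2 / (2 (y + 2))]. *)

Require Import Defs.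
From mathcomp Require Import all_boot all_order all_algebra.
From mathcomp Require Import all_classical all_reals all_analysis.
From mathcomp Require Import measurable_realfun ring lra zify.

Set Implicit Arguments.
Unset Strict Implicit.
Unset Printing Implicit Defensive.

Import Order.TTheory GRing.Theory Num.Theory.
Import numFieldNormedType.Exports.

Local Open Scope classical_set_scope.
Local Open Scope ring_scope.

(** * Massart's inequality *)

(** The numerator collapses to a perfect cube, so the derivative has the sign of [y - 1] and the
    function is minimal at [1]. *)
Lemma is_derive_ln_pade (R : realType) (y : R) : 0 < y ->
  is_derive y 1 (fun z : R => ln z + 4^-1 * z^-1 + 27 / 4 * (z + 2)^-1)
    ((y - 1) ^+ 3 / (y ^+ 2 * (y + 2) ^+ 2)).
Proof.
move=> y0.
have yn0 : y != 0 by lra.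
have y2n0 : y + 2 != 0 by lra.
have dV := @is_deriveV R id y 1 1 yn0 (is_derive_id y 1).
have dS : is_derive y 1 (fun z : R => z + 2) 1.
  have d2 : is_derive y 1 (fun z : R => z + 2) (1 + 0) :=
    is_deriveD (is_derive_id y 1) (is_derive_cst (2 : R) y 1).
  by rewrite addr0 in d2.
have dSV := @is_deriveV R _ y 1 1 y2n0 dS.
have H : is_derive y 1 (fun z : R => ln z + 4^-1 * z^-1 + 27 / 4 * (z + 2)^-1) _ :=
  is_deriveD (is_deriveD (is_derive1_ln y0) (is_deriveZ 4^-1 dV))
    (is_deriveZ (27 / 4) dSV).
apply: (is_derive_eq H).
rewrite /GRing.scale /=.
field.
by rewrite y2n0.
Qed.

(** The left side is the partial fraction form of [(y - 1 + 3 (y - 1)^2 / (2 (y + 2))) / y], so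
    multiplying by [y] gives the bound on [h]. *)
Lemma ln_ge_pade (R : realType) (y : R) : 0 < y ->
  5 / 2 - 4^-1 * y^-1 - 27 / 4 * (y + 2)^-1 <= ln y.
Proof.
move=> y0.
pose f (z : R) := ln z + 4^-1 * z^-1 + 27 / 4 * (z + 2)^-1.
have dfE (z : R) : 0 < z -> is_derive z 1 f ((z - 1) ^+ 3 / (z ^+ 2 * (z + 2) ^+ 2)).
  exact: is_derive_ln_pade.
have df (z : R) : 0 < z -> derivable f z 1 by move/dfE => [].
have f'E (z : R) : 0 < z -> derive1 f z = (z - 1) ^+ 3 / (z ^+ 2 * (z + 2) ^+ 2).
  by move=> z0; rewrite derive1E; have := dfE _ z0 => H; exact: derive_val.
have den (z : R) : 0 < z -> 0 <= (z ^+ 2 * (z + 2) ^+ 2)^-1.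
  by move=> z0; rewrite invr_ge0 mulr_ge0 ?sqr_ge0.
suff : f 1 <= f y.
  rewrite /f ln1 (_ : _ + 27 / 4 * (1 + 2)^-1 = 5 / 2); last by field.
  lra.
have [y1|/ltW y1] := leP 1 y.
- apply: (@ger0_derive1_ndecr R f 1 y) => //.
  + by move=> z /[!in_itv]/= /andP[z1 _]; apply: df; lra.
  + move=> z /[!in_itv]/= /andP[z1 _]; rewrite f'E; last lra.
    by rewrite mulr_ge0 ?den ?exprn_ge0//; lra.
  + by apply: derivable_within_continuous => z /[!in_itv]/= /andP[z1 _]; apply: df; lra.
- apply: (@ler0_derive1_nincr R f y 1) => //.
  + by move=> z /[!in_itv]/= /andP[z1 _]; apply: df; lra.
  + move=> z /[!in_itv]/= /andP[z1 z2]; rewrite f'E; last lra.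
    by rewrite mulr_le0_ge0 ?den ?exprn_odd_le0//; lra.
  + by apply: derivable_within_continuous => z /[!in_itv]/= /andP[z1 _]; apply: df; lra.
Qed.

(* Bennett's inequality weakened to Bernstein's denominator; at [a = 0] the junk
   value [ln 0 = 0] gives the limit [0 ln 0 = 0]. *)
Lemma bernstein_entropy (R : realType) (a b : R) : 0 <= a -> 0 < b ->
  a - b + 3 * (a - b) ^+ 2 / (2 * (a + 2 * b)) <= a * ln (a / b).
Proof.
move=> a0 b0; have [->|an0] := eqVneq a 0.
  rewrite mul0r [X in X <= _](_ : _ = - b / 4); first lra.
  by field; lra.
have {an0} a0 : 0 < a by rewrite lt0r an0.
have /ln_ge_pade := divr_gt0 a0 b0.
move=> /(ler_wpM2l (ltW a0)); apply: le_trans.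
rewrite le_eqVlt; apply/orP; left; apply/eqP.
by field; apply/and3P; split; lra.
Qed.

Lemma expR_ln_pow (R : realType) (c : R) (k : nat) : 0 < c ->
  c ^+ k = expR (k%:R * ln c).
Proof. by move=> c0; rewrite expRM_natl lnK. Qed.

(** The logarithm of the left side is [- n] times the relative entropy of [z] and [p]. In the sum of
    [bernstein_entropy] at [(z, p)] and at [(1 - z, 1 - p)] the linear terms cancel. With
    [m = (2 p + z) / 3] the denominators are multiples of [m] and [1 - m], and
    [1/m + 1/(1 - m) = 1/(m (1 - m))]. *)
Lemma chernoff_le_massart (R : realType) (n k : nat) (p z : R) :
  (0 < n)%N -> k%:R = n%:R * z -> z < p -> p < 1 ->
  (p / z) ^+ k * ((1 - p) / (1 - z)) ^+ (n - k)
    <= expR (- (n%:R * ((p - z) ^+ 2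
         / (2 * ((2 * p + z) / 3 * (1 - (2 * p + z) / 3)))))).
Proof.
move=> n0 kE zp p1.
have n0R : 0 < n%:R :> R by rewrite ltr0n.
have z0 : 0 <= z by rewrite -(pmulr_rge0 _ n0R) -kE.
have p0 : 0 < p by lra.
have kn : (k <= n)%N by rewrite -(ler_nat R); nra.
have -> : (p / z) ^+ k = expR (k%:R * - ln (z / p)).
  (* For [k = 0] also [z = 0] and [p / z] is junk, but the zero exponent makes both sides [1]. *)
  have [->|kn0] := eqVneq k 0%N; first by rewrite mul0r expr0 expR0.
  have zgt0 : 0 < z by rewrite -(pmulr_rgt0 _ n0R) -kE ltr0n lt0n.
  by rewrite -invf_div expR_ln_pow ?invr_gt0 ?divr_gt0// lnV// posrE divr_gt0.
have -> : ((1 - p) / (1 - z)) ^+ (n - k) = expR ((n - k)%:R * - ln ((1 - z) / (1 - p))).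
  have h : 0 < (1 - z) / (1 - p) by apply: divr_gt0; lra.
  by rewrite -invf_div expR_ln_pow ?invr_gt0// lnV// posrE.
rewrite -expRD ler_expR natrB// kE.
have H1 := bernstein_entropy z0 p0.
have H2 := @bernstein_entropy _ (1 - z) (1 - p) ltac:(lra) ltac:(lra).
have H := lerD H1 H2.
have -> : n%:R * z * - ln (z / p) + (n%:R - n%:R * z) * - ln ((1 - z) / (1 - p)) =
  - (n%:R * (z * ln (z / p) + (1 - z) * ln ((1 - z) / (1 - p)))) by ring.
rewrite lerN2 ler_pM2l//; apply: le_trans H.
rewrite le_eqVlt; apply/orP; left; apply/eqP.
field.
by rewrite !lt0r_neq0//=; lra.
Qed.

(* On the event [z <= p - e] the stopping rule, which is Massart's bound for the
   parameter [z + e], implies the same bound for the true parameter [p]. *)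
Lemma massart_threshold (R : realType) (z e p N M : R) :
  0 <= z -> 0 < e -> z + e <= p -> p < 1 -> M < 0 ->
  1 / 4 + e ^+ 2 * N / (2 * M) <= (`|z - 1 / 2| - 2 * e / 3) ^+ 2 ->
  - (N * ((p - z) ^+ 2 / (2 * ((2 * p + z) / 3 * (1 - (2 * p + z) / 3))))) <= M.
Proof.
move=> z0 e0 zp p1 M0 dec.
have uE : (2 * p + z) / 3 = z + 2 * (p - z) / 3 by field.
rewrite uE; set t := p - z.
have te : e <= t by rewrite /t; lra.
have zt : z + t < 1 by rewrite /t; lra.
have {dec} dec : (z + 2 * e / 3) * (1 - z - 2 * e / 3) * - (2 * M) <= e ^+ 2 * N.
  (* Removing the absolute value can only enlarge the square, since [z - 1/2 >= - |z - 1/2|]. Then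
     [1/4 - (z - 1/2 + c)^2] factors as [(z + c) (1 - z - c)]. *)
  have abs : (`|z - 1 / 2| - 2 * e / 3) ^+ 2 <= (z - 1 / 2 + 2 * e / 3) ^+ 2.
    rewrite -subr_ge0 (_ : _ - _ =
      (4 * e / 3) * (z - 1 / 2 + `|z - 1 / 2|) +
      ((z - 1 / 2) ^+ 2 - `|z - 1 / 2| ^+ 2)); last by field.
    rewrite real_normK ?num_real// subrr addr0 mulr_ge0//; first lra.
    by have := ler_norm (- (z - 1 / 2)); rewrite normrN; lra.
  rewrite -ler_pdivlMr; last lra.
  rewrite (_ : e ^+ 2 * N / - (2 * M) = - (e ^+ 2 * N / (2 * M))); last first.
    by field; lra.
  by have := le_trans dec abs; lra.
(* Massart's exponent grows with the gap: [(z + 2 t / 3) / t] and [(1 - z - 2 t / 3) / t] are both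
   nonincreasing in [t], and [e <= t]. *)
have scale : e ^+ 2 * ((z + 2 * t / 3) * (1 - z - 2 * t / 3)) <=
    t ^+ 2 * ((z + 2 * e / 3) * (1 - z - 2 * e / 3)).
  have h1 : e * (z + 2 * t / 3) <= t * (z + 2 * e / 3) by nra.
  have h2 : e * (1 - z - 2 * t / 3) <= t * (1 - z - 2 * e / 3) by nra.
  have h3 : 0 <= e * (z + 2 * t / 3) by rewrite mulr_ge0//; lra.
  have h4 : 0 <= e * (1 - z - 2 * t / 3) by rewrite mulr_ge0//; lra.
  by have := ler_pM h3 h4 h1 h2; lra.
have g0 : 0 < (z + 2 * t / 3) * (1 - (z + 2 * t / 3)) by rewrite mulr_gt0//; lra.
rewrite lerNl mulrA ler_pdivlMr; last lra.
have e20 : 0 < e ^+ 2 by rewrite exprn_gt0.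
rewrite -(ler_pM2l e20).
have M2 : 0 <= - (2 * M) by lra.
have s1 := ler_wpM2r M2 scale.
have s2 := ler_wpM2l (sqr_ge0 t) dec.
lra.
Qed.

(** * The finite Bernoulli model *)

(** The sign hypothesis puts [b] between [x] and [k / n]. Applying [1 + u <= exp u] to [x / b] and
    [(1 - x) / (1 - b)] bounds the likelihood ratio by [exp ((x - b) (k - n b) / (b (1 - b)))], the
    tangent to the log-likelihood at [b]. *)
Lemma likelihood_le (R : realType) (n k : nat) (x b : R) : (k <= n)%N ->
  0 < b < 1 -> 0 <= x <= 1 -> (x - b) * (k%:R - n%:R * b) <= 0 ->
  x ^+ k * (1 - x) ^+ (n - k) <= b ^+ k * (1 - b) ^+ (n - k).
Proof.
move=> kn b01 x01 H.
have b0 : 0 < b by lra.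
have b1 : 0 < 1 - b by lra.
have h1 : x ^+ k <= b ^+ k * expR (k%:R * ((x - b) / b)).
  rewrite mulrC expRM_natl -exprMn lerXn2r ?nnegrE ?mulr_ge0 ?expR_ge0//; [lra|lra|].
  rewrite mulrC.
  rewrite [X in X <= _](_ : x = b * (1 + (x - b) / b)); last by field; lra.
  by rewrite ler_pM2l// expR_ge1Dx.
have h2 : (1 - x) ^+ (n - k) <=
    (1 - b) ^+ (n - k) * expR ((n - k)%:R * ((b - x) / (1 - b))).
  rewrite [X in _ <= X]mulrC expRM_natl -exprMn lerXn2r ?nnegrE ?mulr_ge0 ?expR_ge0//; [lra|lra|].
  rewrite mulrC.
  rewrite [X in X <= _](_ : 1 - x = (1 - b) * (1 + (b - x) / (1 - b))).
    by rewrite ler_pM2l// expR_ge1Dx.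
  by field; lra.
have := ler_pM (exprn_ge0 _ _) (exprn_ge0 _ _) h1 h2.
move/(_ ltac:(lra) ltac:(lra)) => /le_trans; apply.
rewrite mulrACA -expRD ler_piMr// ?mulr_ge0 ?exprn_ge0//; try lra.
rewrite -[X in _ <= X](@expR0 R) ler_expR natrB//.
have -> : k%:R * ((x - b) / b) + (n%:R - k%:R) * ((b - x) / (1 - b)) =
   (x - b) * (k%:R - n%:R * b) / (b * (1 - b)) by field; lra.
by rewrite mulr_le0_ge0// invr_ge0 mulr_ge0//; lra.
Qed.

Definition weight (R : realType) (n : nat) (p : R) (x : {ffun 'I_n -> bool}) : R :=
  \prod_i (if x i then p else 1 - p).

Definition heads (n : nat) (x : {ffun 'I_n -> bool}) : nat := (\sum_i x i)%N.

Definition flip (n : nat) (x : {ffun 'I_n -> bool}) : {ffun 'I_n -> bool} :=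
  [ffun i => ~~ x i].

Lemma flipK (n : nat) : involutive (@flip n).
Proof. by move=> x; apply/ffunP => i; rewrite !ffunE negbK. Qed.

Lemma weight_flip (R : realType) (n : nat) (p : R) (x : {ffun 'I_n -> bool}) :
  weight (1 - p) (flip x) = weight p x.
Proof. by apply: eq_bigr => i _; rewrite ffunE subKr; case: (x i). Qed.

Lemma sum_weight_flip (R : realType) (n : nat) (p : R) (P : pred {ffun 'I_n -> bool}) :
  \sum_(x | P x) weight p x = \sum_(x | P (flip x)) weight (1 - p) x.
Proof.
rewrite (reindex_inj (inv_inj (@flipK n))).
by apply: eq_bigr => x _; rewrite -weight_flip flipK.
Qed.

Lemma heads_le (n : nat) (x : {ffun 'I_n -> bool}) : (heads x <= n)%N.
Proof.
rewrite -[X in (_ <= X)%N]card_ord -sum1_card leq_sum// => i _.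
by case: (x i).
Qed.

Lemma heads_flip (n : nat) (x : {ffun 'I_n -> bool}) : heads (flip x) = (n - heads x)%N.
Proof.
apply/eqP; rewrite -(eqn_add2r (heads x)) subnK ?heads_le// -big_split/=.
rewrite (eq_bigr (fun=> 1%N)) ?sum1_card ?card_ord// => i _.
by rewrite ffunE; case: (x i).
Qed.

Lemma weightE (R : realType) (n : nat) (p : R) (x : {ffun 'I_n -> bool}) :
  weight p x = p ^+ heads x * (1 - p) ^+ (n - heads x).
Proof.
rewrite -heads_flip /heads -!prodrXr -big_split/=; apply: eq_bigr => i _.
by rewrite ffunE; case: (x i); rewrite expr1 expr0 ?mulr1 ?mul1r.
Qed.

Lemma weight_ge0 (R : realType) (n : nat) (p : R) (x : {ffun 'I_n -> bool}) :
  0 <= p <= 1 -> 0 <= weight p x.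
Proof. by move=> p01; rewrite weightE mulr_ge0 ?exprn_ge0//; lra. Qed.

(** Probability generating function of the number of heads, obtained by distributing the product
    over the coordinates. It gives the total mass at [r = 1] and the exponential moment in
    Chernoff's bound. *)
Lemma sum_weight_expr (R : realType) (n : nat) (p r : R) :
  \sum_(x : {ffun 'I_n -> bool}) weight p x * r ^+ heads x = (p * r + (1 - p)) ^+ n.
Proof.
pose F (i : 'I_n) (b : bool) := if b then p * r else 1 - p.
rewrite (eq_bigr (fun x : {ffun 'I_n -> bool} => \prod_i F i (x i))).
  rewrite -(bigA_distr_bigA F) (eq_bigr (fun=> p * r + (1 - p))).
    by rewrite prodr_const card_ord.
  by move=> i _; rewrite big_bool.
move=> x _; rewrite /heads -prodrXr -big_split/=; apply: eq_bigr => i _.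
by rewrite /F; case: (x i); rewrite ?expr1// expr0 mulr1.
Qed.

Lemma sum_weight (R : realType) (n : nat) (p : R) :
  \sum_(x : {ffun 'I_n -> bool}) weight p x = 1.
Proof.
under eq_bigr => x _ do rewrite -[weight p x]mulr1 -[X in _ * X](expr1n _ (heads x)).
by rewrite sum_weight_expr mulr1 addrC subrK expr1n.
Qed.

(** Markov's inequality for [r ^ heads] with [0 <= r <= 1]: on the tail, [r ^ k <= r ^ heads]. *)
Lemma chernoff_tail (R : realType) (n k : nat) (p z : R) :
  (0 < n)%N -> k%:R = n%:R * z -> z < p -> p < 1 ->
  \sum_(x : {ffun 'I_n -> bool} | (heads x <= k)%N) weight p x
    <= (p / z) ^+ k * ((1 - p) / (1 - z)) ^+ (n - k).
Proof.
move=> n0 kE zp p1.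
have n0R : 0 < n%:R :> R by rewrite ltr0n.
have z0 : 0 <= z by rewrite -(pmulr_rge0 _ n0R) -kE.
have p0 : 0 < p by lra.
have kn : (k <= n)%N by rewrite -(ler_nat R); nra.
(* The minimiser of the exponential moment bound, with [r] in the role of [exp(-t)]. *)
pose r := z * (1 - p) / (p * (1 - z)).
have r0 : 0 <= r by rewrite divr_ge0// mulr_ge0//; lra.
have r1 : r <= 1 by rewrite ler_pdivrMr ?mul1r ?mulr_gt0//; nra.
have : r ^+ k * \sum_(x : {ffun 'I_n -> bool} | (heads x <= k)%N) weight p x
    <= ((1 - p) / (1 - z)) ^+ n.
  rewrite (_ : (1 - p) / (1 - z) = p * r + (1 - p)); last first.
    by rewrite /r; field; lra.
  rewrite -sum_weight_expr big_distrr/= big_mkcond/=; apply: ler_sum => x _.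
  have w0 : 0 <= weight p x by apply: weight_ge0; lra.
  case: ifP => [hk|_]; last by rewrite mulr_ge0 ?exprn_ge0.
  by rewrite mulrC ler_wpM2l// ler_wiXn2l.
(* For [k = 0] one has [r = 0], which cannot be divided by, but [r ^ 0 = 1] and the moment bound is
   already the claim. *)
have [k0|kn0] := eqVneq k 0%N; first by rewrite k0 !expr0 !mul1r subn0.
have zgt0 : 0 < z by rewrite -(pmulr_rgt0 _ n0R) -kE ltr0n lt0n.
have rgt0 : 0 < r by rewrite divr_gt0 ?mulr_gt0//; lra.
rewrite -ler_pdivlMl ?exprn_gt0// => /le_trans; apply.
rewrite -[X in _ * _ ^+ X <= _](subnK kn) exprD mulrCA mulrC ler_wpM2r//.
  by rewrite exprn_ge0// divr_ge0//; lra.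
rewrite -exprVn -exprMn (_ : r^-1 * _ = p / z)//.
by rewrite /r; field; rewrite !lt0r_neq0//; lra.
Qed.

(* The [i]-th observation of the finite model, with junk value [0] for [n <= i]. *)
Definition coin (R : realType) (n i : nat) (x : {ffun 'I_n -> bool}) : R :=
  if insub i is Some j then (x j)%:R else 0.

Lemma coinE (R : realType) (n : nat) (j : 'I_n) (x : {ffun 'I_n -> bool}) :
  coin R j x = (x j)%:R.
Proof. by rewrite /coin valK. Qed.

Lemma sample_mean_coin (R : realType) (n : nat) (x : {ffun 'I_n -> bool}) :
  sample_mean (@coin R n) n x = (heads x)%:R / n%:R.
Proof.
rewrite /sample_mean /heads natr_sum; congr (_ / _).
by apply: eq_bigr => i _; rewrite coinE.
Qed.

Lemma sample_mean_flip (R : realType) (n m : nat) (x : {ffun 'I_n -> bool}) :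
  (0 < m <= n)%N ->
  sample_mean (@coin R n) m (flip x) = 1 - sample_mean (@coin R n) m x.
Proof.
move=> /andP[m0 mn]; have m0R : m%:R != 0 :> R by rewrite pnatr_eq0 -lt0n.
rewrite -[1](divff m0R) /sample_mean -mulrBl; congr (_ / _).
rewrite [X in X - _](_ : _ = \sum_(i < m) 1); last by rewrite sumr_const card_ord.
rewrite -sumrB; apply: eq_bigr => i _.
have := coinE R (widen_ord mn i) => /= E.
by rewrite !E ffunE; case: (x _); rewrite ?subrr ?subr0.
Qed.

(** * Transfer between the law of the observations and the finite model *)

Lemma probability_cylinder (d : measure_display) (T : measurableType d) (R : realType)
    (P : probability T R) (X : nat -> T -> R) (p : R) (n : nat)
    (x : {ffun 'I_n -> bool}) : iid_bernoulli P X p ->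
  P (\bigcap_(i in [set` index_iota 0 n]) (X i @^-1` [set coin R i x]))
    = (weight p x)%:E.
Proof.
case=> indep P1 P0.
rewrite (indep _ (fun i => [set coin R i x])) ?iota_uniq// big_mkord -prodEFin.
apply: eq_bigr => i _; rewrite coinE.
by case: (x i); [exact: P1|exact: P0].
Qed.

(** The cylinders over the outcomes in [Q] are disjoint and contained in [A]. *)
Lemma weight_le_probability (d : measure_display) (T : measurableType d) (R : realType)
    (P : probability T R) (X : nat -> {mfun T >-> R}) (p : R) (n : nat)
    (A : set T) (Q : pred {ffun 'I_n -> bool}) :
  iid_bernoulli P X p -> measurable A ->
  (forall w (x : {ffun 'I_n -> bool}), (forall i : 'I_n, X i w = (x i)%:R) -> Q x -> A w) ->
  ((\sum_(x | Q x) weight p x)%:E <= P A)%E.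
Proof.
move=> hX mA QA.
pose C (x : {ffun 'I_n -> bool}) : set T :=
  \bigcap_(i in [set` index_iota 0 n]) (X i @^-1` [set coin R i x]).
have CX x w : C x w -> forall i : 'I_n, X i w = (x i)%:R.
  by move=> Cxw i; rewrite -coinE; apply: Cxw; rewrite /= mem_index_iota ltn_ord.
have mC x : measurable (C x).
  apply: fin_bigcap_measurable; first exact: finite_seq.
  by move=> i _; exact: measurable_funPTI.
have tC : trivIset [set` Q] C.
  move=> x y _ _ [w [Cx Cy]]; apply/ffunP => i; apply/eqP.
  have := CX _ _ Cx i; rewrite (CX _ _ Cy i) => /eqP.
  by rewrite eqr_nat; case: (x i); case: (y i).
have QE : P (\bigcup_(x in [set` Q]) C x) = (\sum_(x | Q x) weight p x)%:E.
  rewrite measure_fin_bigcup//.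
  rewrite -(bigfs _ (index_enum_uniq _))//; last by move=> i _; rewrite mem_index_enum.
  rewrite -sumEFin; apply: eq_bigr => x _; exact: probability_cylinder.
rewrite -QE; apply: le_measure; rewrite ?inE//.
- by exact: fin_bigcup_measurable.
- by move=> w [x Qx /CX Cw]; exact: QA Cw Qx.
Qed.

(* The observations are 0 or 1 only almost surely; applying the inequality to [A]
   and to its complement avoids handling the exceptional null set. *)
Lemma probability_weight (d : measure_display) (T : measurableType d) (R : realType)
    (P : probability T R) (X : nat -> {mfun T >-> R}) (p : R) (n : nat)
    (A : set T) (Q : pred {ffun 'I_n -> bool}) :
  iid_bernoulli P X p -> measurable A ->
  (forall w (x : {ffun 'I_n -> bool}), (forall i : 'I_n, X i w = (x i)%:R) -> A w <-> Q x) ->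
  P A = (\sum_(x | Q x) weight p x)%:E.
Proof.
move=> hX mA QA; apply/eqP; rewrite eq_le; apply/andP; split; last first.
  by apply: (weight_le_probability hX mA) => w x /QA[].
have : ((\sum_(x | ~~ Q x) weight p x)%:E <= P (~` A))%E.
  apply: (weight_le_probability hX (measurableC mA)) => w x /QA[AQ _] nQ Aw.
  by rewrite AQ in nQ.
rewrite probability_setC// -(fineK (fin_num_measure P A mA)).
rewrite -[(1 - _)%E]/((1 - fine (P A))%:E) !lee_fin => h.
have := sum_weight n p; rewrite (bigID Q)/= => h'.
lra.
Qed.

(** * The sampling scheme *)

(** Stated for any total order so that the dual order provides maxima as well. *)
Lemma exists_min (disp : Order.disp_t) (U : orderType disp) (s : seq U) (x : U) :
  x \in s -> exists2 m, m \in s & forall y, y \in s -> (m <= y)%O.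
Proof.
elim: s x => // a s IHs x _.
case: s IHs => [|b s] IHs.
  by exists a; rewrite ?mem_head// => y; rewrite inE => /eqP ->.
have [m ms mP] := IHs b (mem_head _ _).
have [am|ma] := leP a m.
  exists a; rewrite ?mem_head// => y; rewrite in_cons => /orP[/eqP ->//|/mP].
  exact: le_trans.
exists m; first by rewrite in_cons ms orbT.
by move=> y; rewrite in_cons => /orP[/eqP ->|/mP//]; exact: ltW.
Qed.

Section sampling_scheme.
Context {R : realType} (eps delta zeta rho : R).
Hypotheses (heps : 0 < eps < 1 / 2) (hdelta : 0 < delta) (hzeta : 0 < zeta)
  (hzd : zeta * delta < 1) (hrho : 0 < rho).

Local Notation nsize := (nsize eps delta zeta rho).
Local Notation nstages := (nstages eps delta zeta rho).
Local Notation raw_size := (raw_size eps delta zeta rho).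
Local Notation sizes := (sizes eps delta zeta rho).
Local Notation tau := (tau eps rho).
Local Notation phat := (phat eps delta zeta rho).
Local Notation decision := (decision eps delta zeta rho).

(** Stage [0] is allowed, with [nsize 0 = nsize 1] because [0.-1 = 0]; this serves the pair [l.-1],
    [l] at [l = 1]. *)
Lemma nsize_le (l l' : nat) : (l <= l' <= nstages)%N -> (nsize l <= nsize l')%N.
Proof.
case/andP => ll' l's.
have [l'0|l'0] := eqVneq l' 0%N; first by rewrite (_ : l = l')//; lia.
have hs : sorted leq sizes by apply: sort_sorted; exact: leq_total.
apply: (sorted_leq_nth leq_trans leqnn 0%N hs); rewrite ?inE -/nstages; lia.
Qed.

Lemma nstages_le : (nstages <= tau.+1)%N.
Proof.
rewrite /nstages size_sort (leq_trans (size_undup _))//.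
by rewrite size_map size_iota.
Qed.

Lemma ln_zeta_delta_lt0 : ln (zeta * delta) < 0.
Proof. by apply: ln_lt0; rewrite mulr_gt0. Qed.

Lemma growth_ratio_bounds : 0 < 24 * eps - 16 * eps ^+ 2 < 9.
Proof.
case/andP: heps => e0 e1; apply/andP; split.
  rewrite (_ : _ - _ = 8 * eps * (3 - 2 * eps)); last by ring.
  by rewrite mulr_gt0//; lra.
rewrite -subr_gt0 (_ : _ - _ = (3 - 4 * eps) ^+ 2); last by ring.
by rewrite exprn_gt0//; lra.
Qed.

Lemma raw_size_gt0 (i : nat) : (0 < raw_size i)%N.
Proof.
rewrite absz_gt0 gt_eqF// ceil_gt0 mulr_gt0//.
  by rewrite powR_gt0// divr_gt0//; have := growth_ratio_bounds => /andP[].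
have /andP[e0 _] := heps.
rewrite divr_gt0 ?mulr_gt0 ?exprn_gt0//.
by rewrite div1r lnV ?oppr_gt0 ?ln_zeta_delta_lt0// posrE mulr_gt0.
Qed.

Lemma mem_sizes (n : nat) : n \in sizes = (n \in [seq raw_size i | i <- iota 0 tau.+1]).
Proof. by rewrite mem_sort mem_undup. Qed.

Lemma nsize_gt0 (l : nat) : (0 < l <= nstages)%N -> (0 < nsize l)%N.
Proof.
move=> hl; have : nsize l \in sizes by apply: mem_nth; rewrite -/nstages; lia.
by rewrite mem_sizes => /mapP[i _ ->]; exact: raw_size_gt0.
Qed.

Lemma tau_gt0 : (0 < tau)%N.
Proof.
have /andP[h h9] := growth_ratio_bounds.
rewrite absz_gt0 gt_eqF// ceil_gt0 divr_gt0// ln_gt0 ?ltrDl//.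
by rewrite ltr_pdivlMr// mul1r.
Qed.

(** At [i = tau] the exponent [1 - i / tau] vanishes, as [tau] is positive, so [raw_size tau] is the
    ceiling of the left side; the last size is the largest. *)
Lemma last_nsize_ge :
  ln (1 / (zeta * delta)) / (2 * eps ^+ 2) <= (nsize nstages)%:R.
Proof.
have : raw_size tau \in sizes.
  by rewrite mem_sizes map_f// mem_iota; lia.
move/(nthP 0%N) => [j js /= jE].
have le_raw : (raw_size tau <= nsize nstages)%N.
  rewrite -jE -[j]/(j.+1.-1); apply: (@nsize_le j.+1).
  by rewrite leqnn andbT.
apply: le_trans (_ : (raw_size tau)%:R <= _); last by rewrite ler_nat.
rewrite /Defs.raw_size divff ?pnatr_eq0 -?lt0n ?tau_gt0// subrr powRr0.
set y := ln _ / _; rewrite mul1r.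
apply: le_trans (ceil_ge y) _.
by rewrite natr_absz ler_int ler_norm.
Qed.

(** * Stopping stage and error events *)

Section statistics.
Context {T : Type} (X : nat -> T -> R).

Lemma decision_last (w : T) : (0 < nstages)%N -> decision X nstages w.
Proof.
move=> s0; rewrite /decision s0/=.
apply: le_trans (sqr_ge0 _).
have L := ln_zeta_delta_lt0.
have /andP[e0 _] := heps.
have := last_nsize_ge.
rewrite div1r lnV ?posrE ?mulr_gt0// ler_pdivrMr; last by rewrite mulr_gt0// exprn_gt0.
move=> h.
rewrite -subr_ge0 opprD addrA.
rewrite (_ : _ - _ = (eps ^+ 2 * (nsize nstages)%:R * 2 + ln (zeta * delta)) /
   (- (4 * ln (zeta * delta)))); last by field; rewrite lt_eqF.
rewrite divr_ge0//; lra.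
Qed.

Lemma nstages_gt0 : (0 < nstages)%N.
Proof.
have : raw_size 0 \in sizes by rewrite mem_sizes map_f// mem_iota.
by rewrite /nstages; case: sizes.
Qed.

Lemma has_decision (w : T) : has (fun l => decision X l w) (iota 1 nstages).
Proof.
apply/hasP; exists nstages; last exact: decision_last nstages_gt0.
by rewrite mem_iota; have := nstages_gt0; lia.
Qed.

Lemma stopping_stage_bound (w : T) :
  (0 < stopping_stage eps delta zeta rho X w <= nstages)%N.
Proof. by have := has_decision w; rewrite has_find size_iota. Qed.

Lemma decision_stopping (w : T) : decision X (stopping_stage eps delta zeta rho X w) w.
Proof.
have h := has_decision w; have := nth_find 0%N h.
by rewrite nth_iota//; move: h; rewrite has_find size_iota.
Qed.

Lemma decision_before_stopping (w : T) :
  ~~ decision X (stopping_stage eps delta zeta rho X w).-1 w.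
Proof.
(* If stopping occurs at stage [1], the previous stage is [0], where [decision] is false by
   definition. *)
rewrite /stopping_stage/=; case E : (find _ _) => [|j]; first by [].
have jl : (j < find (fun l => decision X l w) (iota 1 nstages))%N by rewrite E.
have := before_find 0%N jl; rewrite nth_iota ?add1n => [->//|].
by rewrite (ltn_trans jl)// -[X in (_ < X)%N](size_iota 1) -has_find has_decision.
Qed.

Definition overshoot (p : R) (l : nat) (w : T) : bool :=
  [&& p + eps <= phat X l w, ~~ decision X l.-1 w & decision X l w].

Definition undershoot (p : R) (l : nat) (w : T) : bool :=
  [&& phat X l w <= p - eps, ~~ decision X l.-1 w & decision X l w].

Lemma overshootP (p : R) (l : nat) (w : T) :
  [/\ phat X l w >= p + eps, decision X l.-1 w = false & decision X l w = true]
  <-> overshoot p l w.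
Proof.
rewrite /overshoot; split; first by case=> -> -> ->.
by case/and3P => ? /negbTE.
Qed.

Lemma undershootP (p : R) (l : nat) (w : T) :
  [/\ phat X l w <= p - eps, decision X l.-1 w = false & decision X l w = true]
  <-> undershoot p l w.
Proof.
rewrite /undershoot; split; first by case=> -> -> ->.
by case/and3P => ? /negbTE.
Qed.

(** The stopping stage is the witness, and the sign of the error selects the side. These events look
    back one stage only, so they may overlap for different [l]; a cover is enough for the union
    bound. *)
Lemma final_error (p : R) (w : T) :
  ~~ (`|final_phat eps delta zeta rho X w - p| < eps) ->
  exists2 l, (0 < l <= nstages)%N & overshoot p l w || undershoot p l w.
Proof.
rewrite -leNgt => err; exists (stopping_stage eps delta zeta rho X w).
  exact: stopping_stage_bound.
rewrite /overshoot /undershoot decision_stopping decision_before_stopping !andbT.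
move: err; rewrite -[final_phat _ _ _ _ X w]/(phat X (stopping_stage eps delta zeta rho X w) w).
by rewrite ler_normr => /orP[?|?]; apply/orP; [left|right]; lra.
Qed.

End statistics.

Lemma sample_mean_ext (T T' : Type) (X : nat -> T -> R) (Y : nat -> T' -> R)
    (n m : nat) (w : T) (x : T') : (m <= n)%N ->
  (forall i : 'I_n, X i w = Y i x) -> sample_mean X m w = sample_mean Y m x.
Proof.
move=> mn XY; congr (_ / _); apply: eq_bigr => i _.
exact: (XY (widen_ord mn i)).
Qed.

Lemma decision_ext (T T' : Type) (X : nat -> T -> R) (Y : nat -> T' -> R)
    (n l : nat) (w : T) (x : T') : (nsize l <= n)%N ->
  (forall i : 'I_n, X i w = Y i x) -> decision X l w = decision Y l x.
Proof. by move=> ln XY; rewrite /decision /phat (sample_mean_ext ln XY). Qed.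

(** The event at stage [l] reads only the first [nsize l] observations, since stage [l.-1] uses no
    more of them. It can therefore be evaluated on finite outcomes. *)
Lemma overshoot_ext (T T' : Type) (X : nat -> T -> R) (Y : nat -> T' -> R)
    (p : R) (l : nat) (w : T) (x : T') : (l <= nstages)%N ->
  (forall i : 'I_(nsize l), X i w = Y i x) -> overshoot X p l w = overshoot Y p l x.
Proof.
move=> ls XY; have hl : (nsize l.-1 <= nsize l)%N by apply: nsize_le; lia.
by rewrite /overshoot /phat (sample_mean_ext (leqnn _) XY)
  (decision_ext (leqnn _) XY) (decision_ext hl XY).
Qed.

Lemma undershoot_ext (T T' : Type) (X : nat -> T -> R) (Y : nat -> T' -> R)
    (p : R) (l : nat) (w : T) (x : T') : (l <= nstages)%N ->
  (forall i : 'I_(nsize l), X i w = Y i x) -> undershoot X p l w = undershoot Y p l x.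
Proof.
move=> ls XY; have hl : (nsize l.-1 <= nsize l)%N by apply: nsize_le; lia.
by rewrite /undershoot /phat (sample_mean_ext (leqnn _) XY)
  (decision_ext (leqnn _) XY) (decision_ext hl XY).
Qed.

(** * Measurability of the events *)

Section measurability.
Context {d : measure_display} {T : measurableType d} (X : nat -> {mfun T >-> R}).

Lemma measurable_sample_mean (n : nat) : measurable_fun setT (sample_mean X n).
Proof. by apply: measurable_funM => //; exact: measurable_sum. Qed.

Lemma measurable_decision (l : nat) :
  measurable_fun setT (decision X l : T -> bool).
Proof.
apply: measurable_and; first exact: measurable_cst.
apply: measurable_fun_ler; first exact: measurable_cst.
apply: measurable_funX; apply: measurable_funB => //.
apply: measurableT_comp => //; apply: measurable_funB => //.
exact: measurable_sample_mean.
Qed.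

Lemma measurable_bool (f : T -> bool) : measurable_fun setT f -> measurable [set w | f w].
Proof. by move=> mf; rewrite -[X in measurable X]setTI; exact: (mf measurableT [set true]). Qed.

Lemma measurable_overshoot (p : R) (l : nat) : measurable [set w | overshoot X p l w].
Proof.
apply: measurable_bool; apply: measurable_and.
  by apply: measurable_fun_ler => //; exact: measurable_sample_mean.
by apply: measurable_and; [apply: measurable_neg|]; exact: measurable_decision.
Qed.

Lemma measurable_undershoot (p : R) (l : nat) : measurable [set w | undershoot X p l w].
Proof.
apply: measurable_bool; apply: measurable_and.
  by apply: measurable_fun_ler => //; exact: measurable_sample_mean.
by apply: measurable_and; [apply: measurable_neg|]; exact: measurable_decision.
Qed.

Lemma measurable_find (s : seq nat) (j : nat) :
  measurable [set w | find (fun l => decision X l w) s = j].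
Proof.
elim: s j => [|l s IHs] j /=.
  have [->|j0] := eqVneq j 0%N.
    by rewrite (_ : mkset _ = setT)//; apply/seteqP; split.
  rewrite (_ : mkset _ = set0)//.
  by apply/seteqP; split => w //= /esym/eqP; rewrite (negbTE j0).
have mD := measurable_bool (measurable_decision l).
case: j => [|j].
  rewrite (_ : mkset _ = [set w | decision X l w])//.
  by apply/seteqP; split => w /=; case: ifP.
rewrite (_ : mkset _ = ~` [set w | decision X l w] `&`
    [set w | find (fun l => decision X l w) s = j]).
  by apply: measurableI => //; exact: measurableC.
by apply/seteqP; split => w /=; case: ifP => //= _ [] // _ ->.
Qed.

(** On each piece of the countable partition by the value of [find], the final estimate is the mean
    at a fixed stage. *)
Lemma measurable_final_error (p : R) :
  measurable [set w | `|final_phat eps delta zeta rho X w - p| < eps].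
Proof.
rewrite (_ : mkset _ = \bigcup_j
   ([set w | find (fun l => decision X l w) (iota 1 nstages) = j] `&`
    [set w | `|phat X j.+1 w - p| < eps])).
  apply: bigcup_measurable => j _; apply: measurableI; first exact: measurable_find.
  apply: measurable_bool; apply: measurable_fun_ltr => //.
  apply: measurableT_comp => //; apply: measurable_funB => //.
  exact: measurable_sample_mean.
apply/seteqP; split => w /=.
  by move=> h; exists (find (fun l => decision X l w) (iota 1 nstages)).
by case=> j _ [/= jE]; rewrite /final_phat /final_size /stopping_stage jE.
Qed.

End measurability.

(** A finite sum that does not mention the laws [Pr p], so that different parameters can be compared
    term by term. *)
Definition over_mass (p : R) (l : nat) : R :=
  \sum_(x : {ffun 'I_(nsize l) -> bool} | overshoot (@coin R (nsize l)) p l x) weight p x.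

Definition under_mass (p : R) (l : nat) : R :=
  \sum_(x : {ffun 'I_(nsize l) -> bool} | undershoot (@coin R (nsize l)) p l x) weight p x.

Lemma probability_overshoot (d : measure_display) (T : measurableType d)
    (P : probability T R) (X : nat -> {mfun T >-> R}) (p : R) (l : nat) :
  iid_bernoulli P X p -> (l <= nstages)%N ->
  P [set w | overshoot X p l w] = (over_mass p l)%:E.
Proof.
move=> hX ls; apply: (probability_weight hX (measurable_overshoot X p l)) => w x Xx.
rewrite /= (@overshoot_ext _ _ X (@coin R (nsize l)) p l w x)// => i.
by rewrite coinE.
Qed.

Lemma probability_undershoot (d : measure_display) (T : measurableType d)
    (P : probability T R) (X : nat -> {mfun T >-> R}) (p : R) (l : nat) :
  iid_bernoulli P X p -> (l <= nstages)%N ->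
  P [set w | undershoot X p l w] = (under_mass p l)%:E.
Proof.
move=> hX ls; apply: (probability_weight hX (measurable_undershoot X p l)) => w x Xx.
rewrite /= (@undershoot_ext _ _ X (@coin R (nsize l)) p l w x)// => i.
by rewrite coinE.
Qed.

Lemma decision_flip (n l : nat) (x : {ffun 'I_n -> bool}) :
  (l <= nstages)%N -> (nsize l <= n)%N ->
  decision (@coin R n) l (flip x) = decision (@coin R n) l x.
Proof.
move=> ls ln; rewrite /decision; case: (ltnP 0 l) => //= l0.
rewrite /phat sample_mean_flip ?ln ?nsize_gt0 ?l0//.
rewrite (_ : 1 - _ - _ = - (sample_mean (@coin R n) (nsize l) x - 1 / 2)); last by field.
by rewrite normrN.
Qed.

(** Exchanging heads and tails replaces the mean by its complement to [1] and preserves the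
    decisions, which depend only on the distance of the mean to [1/2]. *)
Lemma over_mass_symmetric (p : R) (l : nat) : (0 < l <= nstages)%N ->
  over_mass (1 - p) l = under_mass p l.
Proof.
move=> hl; have /andP[l0 ls] := hl.
rewrite /over_mass sum_weight_flip subKr; apply: eq_bigl => x.
have hl1 : (nsize l.-1 <= nsize l)%N by apply: nsize_le; lia.
rewrite /overshoot /undershoot !decision_flip//; last lia.
rewrite /phat sample_mean_flip ?nsize_gt0 ?leqnn//.
by congr (_ && _); apply/idP/idP; lra.
Qed.

(** The last hypothesis says that no value of [phat] lies in [[p + eps, b + eps)]. Hence every
    outcome in the event has [phat >= b + eps], its likelihood increases from [p] to [b], and it
    stays in the event for [b]. *)
Lemma over_mass_le (p b : R) (l : nat) : (0 < l <= nstages)%N -> 0 < p -> p <= b -> b < 1 ->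
  (forall k : nat, p + eps <= k%:R / (nsize l)%:R -> b + eps <= k%:R / (nsize l)%:R) ->
  over_mass p l <= over_mass b l.
Proof.
move=> hl p0 pb b1 nogap; have n0 := nsize_gt0 hl; have /andP[e0 _] := heps.
apply: le_trans (_ : \sum_(x : {ffun 'I_(nsize l) -> bool} |
    overshoot (@coin R (nsize l)) p l x) weight b x <= _).
  apply: ler_sum => x /and3P[+ _ _]; rewrite /phat sample_mean_coin => /nogap.
  rewrite ler_pdivlMr ?ltr0n// => h; rewrite !weightE.
  apply: likelihood_le; rewrite ?heads_le//; try lra.
  rewrite mulr_le0_ge0//; first lra.
  have : 0 <= eps * (nsize l)%:R by rewrite mulr_ge0// ltW.
  lra.
rewrite [leLHS]big_mkcond [leRHS]big_mkcond; apply: ler_sum => x _.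
have w0 : 0 <= weight b x by apply: weight_ge0; lra.
rewrite /overshoot /phat sample_mean_coin.
case: ifP => [/and3P[/nogap -> -> ->]//|_]; by case: ifP.
Qed.

Lemma under_mass_le (p a : R) (l : nat) : (0 < l <= nstages)%N -> 0 < a -> a <= p -> p < 1 ->
  (forall k : nat, k%:R / (nsize l)%:R <= p - eps -> k%:R / (nsize l)%:R <= a - eps) ->
  under_mass p l <= under_mass a l.
Proof.
move=> hl a0 ap p1 nogap; have n0 := nsize_gt0 hl; have /andP[e0 _] := heps.
apply: le_trans (_ : \sum_(x : {ffun 'I_(nsize l) -> bool} |
    undershoot (@coin R (nsize l)) p l x) weight a x <= _).
  apply: ler_sum => x /and3P[+ _ _]; rewrite /phat sample_mean_coin => /nogap.
  rewrite ler_pdivrMr ?ltr0n// => h; rewrite !weightE.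
  apply: likelihood_le; rewrite ?heads_le//; try lra.
  rewrite mulr_ge0_le0//; first lra.
  have : 0 <= eps * (nsize l)%:R by rewrite mulr_ge0// ltW.
  lra.
rewrite [leLHS]big_mkcond [leRHS]big_mkcond; apply: ler_sum => x _.
have w0 : 0 <= weight a x by apply: weight_ge0; lra.
rewrite /undershoot /phat sample_mean_coin.
case: ifP => [/and3P[/nogap -> -> ->]//|_]; by case: ifP.
Qed.

(** The event lies in the lower tail cut at its own outcome with the most heads. That outcome
    satisfies the stopping rule, so [massart_threshold] applies at its mean [z]. *)
Lemma under_mass_le_zeta (p : R) (l : nat) : 0 < p < 1 -> (0 < l <= nstages)%N ->
  under_mass p l <= zeta * delta.
Proof.
move=> /andP[p0 p1] hl; have n0 := nsize_gt0 hl; have /andP[e0 _] := heps.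
have n0R : 0 < (nsize l)%:R :> R by rewrite ltr0n.
rewrite /under_mass; set Q : pred {ffun 'I_(nsize l) -> bool} :=
  fun x => undershoot (@coin R (nsize l)) p l x.
have [x0 Qx0|Q0] := pickP Q; last first.
  by rewrite big_pred0 // ltW// mulr_gt0.
have [x Qx xmax] := arg_maxnP (fun x => heads x) Qx0.
have := Qx; rewrite /Q /undershoot => /and3P[+ _ /andP[_]].
rewrite /phat sample_mean_coin; set z := _ / _ => zp dec.
have kE : (heads x)%:R = (nsize l)%:R * z.
  by rewrite /z mulrCA divff ?mulr1// gt_eqF.
have z0 : 0 <= z by rewrite divr_ge0.
apply: le_trans (_ : \sum_(y : {ffun 'I_(nsize l) -> bool} | (heads y <= heads x)%N)
    weight p y <= _).
  rewrite [leLHS]big_mkcond [leRHS]big_mkcond; apply: ler_sum => y _.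
  have w0 : 0 <= weight p y by apply: weight_ge0; lra.
  by case: ifP => [/xmax hy|_]; [rewrite ifT|case: ifP].
have zltp : z < p by lra.
apply: (le_trans (chernoff_tail n0 kE zltp p1)).
apply: (le_trans (chernoff_le_massart n0 kE zltp p1)).
rewrite -[leRHS]lnK ?posrE ?mulr_gt0// ler_expR.
apply: massart_threshold dec => //; [lra|exact: ln_zeta_delta_lt0].
Qed.

Lemma over_mass_le_zeta (p : R) (l : nat) : 0 < p < 1 -> (0 < l <= nstages)%N ->
  over_mass p l <= zeta * delta.
Proof.
move=> p01 hl; rewrite -[p](subKr 1) over_mass_symmetric//.
by apply: under_mass_le_zeta => //; lra.
Qed.

Lemma sum_stages_lt (F : nat -> R) : zeta < 1 / (2 * (tau%:R + 1)) ->
  (forall l, (0 < l <= nstages)%N -> F l <= zeta * delta) ->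
  \sum_(1 <= l < nstages.+1) F l < delta / 2.
Proof.
move=> hz hF.
apply: le_lt_trans (_ : tau.+1%:R * (zeta * delta) < _).
  apply: le_trans (_ : \sum_(1 <= l < nstages.+1) zeta * delta <= _).
    by rewrite big_nat_cond [leRHS]big_nat_cond; apply: ler_sum => l /andP[? _]; apply: hF; lia.
  rewrite sumr_const_nat subn1 /= -[leLHS]mulr_natl ler_wpM2r ?ler_nat ?nstages_le//.
  by rewrite ltW// mulr_gt0.
have t0 : 0 < tau.+1%:R :> R by [].
move: hz; rewrite natr1 ltr_pdivlMr ?mulr_gt0// => hz.
rewrite mulrA ltr_pdivlMr// (_ : _ * 2 = zeta * (2 * tau.+1%:R) * delta); last by ring.
by rewrite -[ltRHS]mul1r ltr_pM2r.
Qed.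

(* The overshoot event is constant, and its probability nondecreasing, as the
   parameter increases from [p] to the next point of [Qminus]. *)
Lemma sum_over_mass_lt :
  (forall p, Qminus eps delta zeta rho p ->
    \sum_(1 <= l < nstages.+1) over_mass p l < delta / 2) ->
  forall p, 0 < p <= 1 / 2 -> \sum_(1 <= l < nstages.+1) over_mass p l < delta / 2.
Proof.
move=> hQ p /andP[p0 p12]; have /andP[e0 e12] := heps.
(* Only the attainable means [k / n] with [0 <= k <= n] matter, which gives a finite list. Adding
   [1/2] ensures that a next point [b >= p] exists. *)
pose grid : seq R := [seq k%:R / (nsize l)%:R - eps | l <- iota 1 nstages,
  k <- iota 0 (nsize l).+1].
pose S := [seq q <- 1 / 2 :: grid | p <= q <= 1 / 2].
have S12 : 1 / 2 \in S by rewrite mem_filter mem_head p12 lexx.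
have [b] := exists_min S12; rewrite mem_filter => /andP[/andP[pb b12] bgrid] bmin.
have Qb : Qminus eps delta zeta rho b.
  have [->|bn12] := eqVneq b (1 / 2); first by right.
  left; move: bgrid; rewrite in_cons (negbTE bn12)/= => /allpairsPdep.
  case=> l [k [hl _ bE]]; exists l; first by move: hl; rewrite mem_iota /=; lia.
  split; last by exists k.
  by apply/andP; split; [lra|rewrite lt_neqAle bn12].
apply: le_lt_trans (hQ _ Qb).
rewrite big_nat_cond [leRHS]big_nat_cond; apply: ler_sum => l /andP[hl _].
have n0 : 0 < (nsize l)%:R :> R by rewrite ltr0n nsize_gt0//; lia.
apply: over_mass_le => //; first lra.
move=> k kp.
(* A mean in [[p + eps, b + eps)] would give a grid point in [[p, b)], against the minimality of
   [b]. *)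
rewrite leNgt; apply/negP => kb.
have : k%:R / (nsize l)%:R - eps \in S.
  rewrite mem_filter in_cons; apply/andP; split; first lra.
  apply/orP; right; apply/allpairsPdep; exists l, k; split => //.
    by rewrite mem_iota add1n.
  by rewrite mem_iota leq0n add0n ltnS -(ler_nat R) -[leRHS]mul1r -ler_pdivrMr//; lra.
by move/bmin; lra.
Qed.

(** Mirror argument: the parameter decreases to the preceding point of [Qplus], a maximum found as a
    minimum in the dual order [R^d]. *)
Lemma sum_under_mass_lt :
  (forall p, Qplus eps delta zeta rho p ->
    \sum_(1 <= l < nstages.+1) under_mass p l < delta / 2) ->
  forall p, 0 < p <= 1 / 2 -> \sum_(1 <= l < nstages.+1) under_mass p l < delta / 2.
Proof.
move=> hQ p /andP[p0 p12]; have /andP[e0 e12] := heps.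
have [->|pn12] := eqVneq p (1 / 2); first by apply: hQ; right.
pose grid : seq R := [seq k%:R / (nsize l)%:R + eps | l <- iota 1 nstages,
  k <- iota 0 (nsize l).+1].
pose S : seq R^d := [seq q <- grid | q <= p].
have memS l k : (0 < l <= nstages)%N -> k%:R / (nsize l)%:R <= p - eps ->
    k%:R / (nsize l)%:R + eps \in S.
  move=> hl kp; have n0 : 0 < (nsize l)%:R :> R by rewrite ltr0n nsize_gt0.
  rewrite mem_filter; apply/andP; split; first lra.
  apply/allpairsPdep; exists l, k; split => //.
    by rewrite mem_iota add1n.
  by rewrite mem_iota leq0n add0n ltnS -(ler_nat R) -[leRHS]mul1r -ler_pdivrMr//; lra.
(* With no grid point up to [p], no attainable mean is at most [p - eps], and every undershoot event
   is empty. *)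
case ES : S => [|a0 S'].
  rewrite big_nat_cond big1 ?divr_gt0// => l /andP[hl _].
  rewrite /under_mass big_pred0// => x; apply/negP => /and3P[+ _ _].
  rewrite /phat sample_mean_coin => /memS; rewrite ES => /(_ ltac:(lia)).
  by rewrite in_nil.
have a0S : a0 \in S by rewrite ES mem_head.
have [a] := exists_min a0S.
rewrite mem_filter => /andP[ap /allpairsPdep [l [k [hl _ aE]]]] amax.
have hl' : (0 < l <= nstages)%N by move: hl; rewrite mem_iota; lia.
have ap0 : 0 < (a : R).
  by rewrite aE ltr_wpDl// divr_ge0.
have Qa : Qplus eps delta zeta rho a.
  left; exists l; first by [].
  split; last by exists k.
  by rewrite ap0 (le_lt_trans ap)// lt_neqAle pn12 p12.
apply: le_lt_trans (hQ _ Qa).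
rewrite big_nat_cond [leRHS]big_nat_cond; apply: ler_sum => l' /andP[hl1 _].
apply: under_mass_le => //; first lra.
move=> k' kp.
have /amax : k'%:R / (nsize l')%:R + eps \in S by apply: memS => //; lia.
by rewrite leEdual -lerBrDr.
Qed.

End sampling_scheme.

Theorem theorem1 (R : realType) (d : measure_display) (T : measurableType d)
    (Pr : R -> probability T R) (X : nat -> {mfun T >-> R})
    (hX : forall p : R, 0 < p < 1 -> iid_bernoulli (Pr p) X p)
    (eps delta zeta rho : R)
    (heps : 0 < eps < 1 / 2) (hdelta : 0 < delta < 1)
    (hzeta : 0 < zeta) (hzd : zeta * delta < 1) (hrho : 0 < rho) :
  (upper_condition eps delta zeta rho Pr X ->
   lower_condition eps delta zeta rho Pr X ->
   forall p : R, 0 < p < 1 ->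
     ((1 - delta)%:E <
      Pr p [set w | (`|final_phat eps delta zeta rho X w - p| < eps)%R])%E)
  /\
  (0 < zeta < 1 / (2 * ((tau eps rho)%:R + 1)) ->
   upper_condition eps delta zeta rho Pr X /\
   lower_condition eps delta zeta rho Pr X).
Proof.
have /andP[d0 _] := hdelta.
pose s := nstages eps delta zeta rho.
pose over := over_mass eps delta zeta rho.
pose under := under_mass eps delta zeta rho.
have PrU p l : 0 < p < 1 -> (l <= s)%N ->
    Pr p [set w | overshoot eps delta zeta rho X p l w] = (over p l)%:E.
  by move=> p01 ls; apply: probability_overshoot => //; exact: hX.
have PrL p l : 0 < p < 1 -> (l <= s)%N ->
    Pr p [set w | undershoot eps delta zeta rho X p l w] = (under p l)%:E.
  by move=> p01 ls; apply: probability_undershoot => //; exact: hX.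
have sumU p : 0 < p < 1 -> (\sum_(1 <= l < s.+1) Pr p [set w |
    [/\ (phat eps delta zeta rho X l w >= p + eps)%R,
        decision eps delta zeta rho X l.-1 w = false &
        decision eps delta zeta rho X l w = true]] =
    (\sum_(1 <= l < s.+1) over p l)%R%:E)%E.
  move=> p01; rewrite -sumEFin; apply: eq_big_nat => l /andP[_ ls].
  rewrite -PrU//; congr (Pr p _); apply/seteqP.
  by split => w /=; rewrite overshootP.
have sumL p : 0 < p < 1 -> (\sum_(1 <= l < s.+1) Pr p [set w |
    [/\ (phat eps delta zeta rho X l w <= p - eps)%R,
        decision eps delta zeta rho X l.-1 w = false &
        decision eps delta zeta rho X l w = true]] =
    (\sum_(1 <= l < s.+1) under p l)%R%:E)%E.
  move=> p01; rewrite -sumEFin; apply: eq_big_nat => l /andP[_ ls].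
  rewrite -PrL//; congr (Pr p _); apply/seteqP.
  by split => w /=; rewrite undershootP.
have Qm01 p : Qminus eps delta zeta rho p -> 0 < p < 1.
  by case=> [[l _ [+ _]]|/= ->]; lra.
have Qp01 p : Qplus eps delta zeta rho p -> 0 < p < 1.
  by case=> [[l _ [+ _]]|/= ->]; lra.
split; last first.
  move=> /andP[_ hz]; split=> p Qp.
    rewrite sumU ?lte_fin; last exact: Qm01.
    by apply: sum_stages_lt => // l hl; apply: over_mass_le_zeta => //; exact: Qm01.
  rewrite sumL ?lte_fin; last exact: Qp01.
  by apply: sum_stages_lt => // l hl; apply: under_mass_le_zeta => //; exact: Qp01.
move=> hU hL p p01.
have over_lt q : 0 < q <= 1 / 2 -> \sum_(1 <= l < s.+1) over q l < delta / 2.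
  apply: sum_over_mass_lt => // r Qr.
  by rewrite -lte_fin -sumU; [exact: hU|exact: Qm01].
have under_lt q : 0 < q <= 1 / 2 -> \sum_(1 <= l < s.+1) under q l < delta / 2.
  apply: sum_under_mass_lt => // r Qr.
  by rewrite -lte_fin -sumL; [exact: hL|exact: Qp01].
have sym q : \sum_(1 <= l < s.+1) over (1 - q) l = \sum_(1 <= l < s.+1) under q l.
  by apply: eq_big_nat => l hl; apply: over_mass_symmetric.
have total : \sum_(1 <= l < s.+1) (over p l + under p l) < delta.
  rewrite big_split/= [ltRHS]splitr.
  (* For [p > 1/2] the two sums at [p] are those at [1 - p] with their roles exchanged. *)
  have [p12|p12] := leP p (1 / 2).
    by apply: ltrD; [apply: over_lt|apply: under_lt]; lra.
  have := sym (1 - p); rewrite subKr => ->; rewrite -(sym p).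
  by apply: ltrD; [apply: under_lt|apply: over_lt]; lra.
set A := [set w | _].
have mA : measurable A by exact: measurable_final_error.
(* Indexed from [0], so [err l] concerns stage [l + 1]. *)
pose err l := [set w | overshoot eps delta zeta rho X p l.+1 w] `|`
  [set w | undershoot eps delta zeta rho X p l.+1 w].
have merr l : measurable (err l).
  by apply: measurableU; [exact: measurable_overshoot|exact: measurable_undershoot].
have AC : ~` A `<=` \big[setU/set0]_(l < s) err l.
  move=> w /= /negP errw.
  have [l /andP[l0 ls] olul] := final_error heps d0 hzeta hzd hrho errw.
  have ls' : (l.-1 < s)%N by rewrite prednK.
  apply: (bigsetU_sup ls'); rewrite /err prednK//.
  by case/orP: olul; [left|right].
have PAC : (Pr p (~` A) < delta%:E)%E.
  have merr' k : `I_s k -> measurable (err k) by [].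
  apply: le_lt_trans (content_subadditive (Pr p) merr' (measurableC mA) AC) _.
  apply: le_lt_trans (_ : (\sum_(l < s) (over p l.+1 + under p l.+1)%R%:E < _)%E).
    apply: lee_sum => l _; rewrite EFinD -PrU// -PrL//.
    by apply: measureU2; [exact: measurable_overshoot|exact: measurable_undershoot].
  by rewrite sumEFin lte_fin -(big_mkord xpredT (fun l => over p l.+1 + under p l.+1))
    -(big_add1 _ _ 0%N s.+1 xpredT (fun l => over p l + under p l)).
move: PAC; rewrite probability_setC// -(fineK (fin_num_measure (Pr p) A mA)).
rewrite -[(1 - _)%E]/((1 - fine (Pr p A))%:E) !lte_fin; lra.
Qed.
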